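(* Let $\Phi:\mathbb{X}\to\overline{\mathbb{R}}$ be proper, lower semicontinuous and bounded from below, let $m\in\mathbb{N}$, let $\{x^k\}_{k\in\mathbb{N}}\subset\mathbb{X}$ with $\Phi(x^0)<\infty$, and let $\{z^k\}_{k\in\mathbb{N}}\subset\mathbb{Z}=\mathbb{X}\times\mathbb{Y}$ satisfy $\mathcal{P}_{\mathbb{X}}(z^k)=x^k$ for all $k$. Suppose the following four conditions hold. (a) There is $a>0$ such that $\Phi(x^{k+1})+a\|x^{k+1}-x^k\|^2\le\Phi(x^{\ell(k)})$ for all $k\in\mathbb{N}$. (b) For every convergent subsequence $\{x^{\ell(k_j)}\}_{j\in\mathbb{N}}$, $\limsup_{j\to\infty}\Phi(x^{\ell(k_j)})\le\Phi(\lim_{j\to\infty}x^{\ell(k_j)})$. (c) There exist a proper lower semicontinuous function $\Theta:\mathbb{Z}\to\overline{\mathbb{R}}$ that is a KL function of exponent $\theta\in[0,1)$, a sequence $\varsigma_k\ge 0$ with $\lim_{k\to\infty}\varsigma_k=0$, and $b>0$ such that $\Theta(z)\ge\Phi(\mathcal{P}_{\mathbb{X}}(z))$ for every $z\in Z^*$ (the set of cluster points of $\{z^k\}$), $\Phi(x^{k+1})\le\Theta(z^{k+1})\le\Phi(x^{\ell(k)})+\varsigma_k$ for all $k\in\mathbb{N}$, and ${\rm dist}(0,\partial\Theta(z^k))\le b\|x^k-x^{k-1}\|$ for all $k\ge 1$. (d) There exist $\tau\in(0,1)$, $\mu>0$ and an integer $\overline{k}>m$ such that for each $k\ge\overline{k}$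 and every integer $i$ with $\ell(k-1)+1\le i\le\ell(k)-1$, $$\sqrt{\Phi(x^{\ell(k)})-\Phi(x^i)}\le\tau\sqrt{a}\,\|x^i-x^{i-1}\|+\mu\sum_{j=i+1}^{\ell(k)}\|x^j-x^{j-1}\|.$$ Suppose moreover that $\{z^k\}_{k\in\mathbb{N}}$ is bounded. Then $\{x^k\}$ converges to some $\overline{x}\in\mathbb{X}$, and: (i) if $\theta=0$, then $\{x^k\}$ converges to $\overline{x}$ within a finite number of steps (i.e. $x^k=\overline{x}$ for all sufficiently large $k$); (ii) if $\theta\in(0,1)$, there exist $\gamma>0$ and $\varrho\in(0,1)$ such that for all $k$ large enough, $$\|x^k-\overline{x}\|\le\sum_{j=k}^\infty\|x^{j+1}-x^j\|\le\begin{cases}\gamma\varrho^k&\text{if }\theta\in(0,1/2],\\ \gamma k^{\frac{1-\theta}{1-2\theta}}&\text{if }\theta\in(1/2,1).\end{cases}$$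
   Context: $\mathbb{X}$ and $\mathbb{Y}$ are finite-dimensional real inner product spaces ($\mathbb{Y}=\{0\}$ is allowed, in which case $\mathbb{Z}$ is identified with $\mathbb{X}$), $\|\cdot\|$ is the induced norm, $\mathcal{P}_{\mathbb{X}}(x,y)=x$ for $(x,y)\in\mathbb{Z}=\mathbb{X}\times\mathbb{Y}$, $\overline{\mathbb{R}}=(-\infty,\infty]$, $\mathbb{N}=\{0,1,2,\dots\}$. For $k\in\mathbb{N}$, $\ell(k)$ is the largest index in $\arg\max\{\Phi(x^j): j=\max\{0,k-m\},\dots,k\}$. $\partial$ denotes the limiting (Mordukhovich) subdifferential, and ${\rm dist}(0,\emptyset)=\infty$. KL property of exponent $\theta\in[0,1)$: a proper function $h$ has the KL property of exponent $\theta$ at $\overline{x}\in{\rm dom}\,\partial h$ if there exist $\eta\in(0,\infty]$, a neighborhood $\mathcal{U}$ of $\overline{x}$ and $c>0$ such that, with $\varphi(t)=ct^{1-\theta}$, $\varphi'(h(x)-h(\overline{x}))\,{\rm dist}(0,\partial h(x))\ge1$ for all $x\in\mathcal{U}$ with $h(\overline{x})<h(x)<h(\overline{x})+\eta$. $h$ is a KL function of exponent $\theta$ if this holds at every point of ${\rm dom}\,\partial h$. *)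

(* Defs.v *)
From HB Require Import structures.
From mathcomp Require Import all_boot all_order all_algebra.
From mathcomp Require Import all_classical all_reals all_analysis.
From mathcomp Require Import ring lra.

Set Implicit Arguments.
Unset Strict Implicit.
Unset Printing Implicit Defensive.

Import Order.TTheory GRing.Theory Num.Theory.
Import numFieldNormedType.Exports.

Local Open Scope classical_set_scope.
Local Open Scope ring_scope.

HB.mixin Record NormedModule_isInnerProduct (R : realType) (E : Type)
    of NormedModule R E := {
  inner : {dot E for (@idfun R)} ;
  normr_inner : forall u : E, `|u| = Num.sqrt (inner u u) }.

(* Finite-dimensional real inner product spaces with the induced norm; finite
   dimensionality is carried by the [Vector] component. *)
#[short(type="euclideanType")]
HB.structure Definition Euclidean (R : realType) :=
  {E of NormedModule R E & Vector R E & NormedModule_isInnerProduct R E}.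

Section InnerTheory.
Context (R : realType) (X : euclideanType R).
Implicit Types (u v w : X) (a : R).

Lemma innerC u v : inner u v = inner v u.
Proof. by rewrite [LHS]hermitian_subproof mul1r. Qed.

Lemma inner_linearl v : linear_for *%R (fun u => inner u v).
Proof. by move=> a u w; rewrite /= linearPl. Qed.

Lemma inner_linearr u : linear_for *%R (inner u).
Proof. by move=> a v w; rewrite innerC inner_linearl !(innerC u). Qed.

Lemma inner_gt0 u : u != 0 -> 0 < inner u u.
Proof. exact: neq0_dnorm_gt0. Qed.

End InnerTheory.

(* The product with inner product <u.1, v.1> + <u.2, v.2>; a type alias, since
   MathComp-Analysis equips [X * Y] with the sup norm. *)
Definition l2prod (R : realType) (X Y : euclideanType R) : Type := (X * Y)%type.

Section L2Prod.
Context (R : realType) (X Y : euclideanType R).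

HB.instance Definition _ := Vector.copy (l2prod X Y) (X * Y)%type.

Definition l2inner (u v : l2prod X Y) : R := inner u.1 v.1 + inner u.2 v.2.

Fact l2inner_hermitian u v :
  l2inner u v = (-1) ^+ false * @idfun R (l2inner v u).
Proof. by rewrite mul1r /l2inner innerC [X in _ + X]innerC. Qed.

Fact l2inner_linearl v : linear_for *%R (l2inner ^~ v).
Proof. by move=> a u w; rewrite /l2inner /= !linearPl /=; ring. Qed.

Fact l2inner_linearr u : linear_for (@idfun R \; *%R) (l2inner u).
Proof.
by move=> a v w; rewrite /l2inner /= !inner_linearr; ring.
Qed.

HB.instance Definition _ := @bilinear_isBilinear.Build R (l2prod X Y)
  (l2prod X Y) R *%R (@idfun R \; *%R) l2inner
  (l2inner_linearl, l2inner_linearr).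

HB.instance Definition _ := @isHermitianSesquilinear.Build R (l2prod X Y)
  false idfun l2inner l2inner_hermitian.

Fact l2inner_gt0 (u : l2prod X Y) : u != 0 -> 0 < l2inner u u.
Proof.
have ge0 (E : euclideanType R) (e : E) : 0 <= inner e e.
  by have [->|/inner_gt0/ltW//] := eqVneq e 0; rewrite linear0l.
case: u => u1 u2 u0; rewrite /l2inner /=.
have [u10|/inner_gt0 u1_gt0] := eqVneq u1 0; last exact: ltr_wpDr.
have [u20|/inner_gt0 u2_gt0] := eqVneq u2 0; last exact: ltr_wpDl.
by move: u0; rewrite u10 u20 eqxx.
Qed.

HB.instance Definition _ := @isDotProduct.Build R (l2prod X Y) l2inner
  l2inner_gt0.

Definition l2norm (u : l2prod X Y) : R := Num.sqrt (l2inner u u).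

Fact l2inner_ge0 (u : l2prod X Y) : 0 <= l2inner u u.
Proof.
by have [->|/l2inner_gt0/ltW//] := eqVneq u 0; rewrite linear0l.
Qed.

Fact l2norm_triangle (u v : l2prod X Y) : l2norm (u + v) <= l2norm u + l2norm v.
Proof.
have expand (t : R) : l2inner (t *: u + v) (t *: u + v) =
    t ^+ 2 * l2inner u u + 2 * t * l2inner u v + l2inner v v.
  rewrite l2inner_linearl !l2inner_linearr /= (l2inner_hermitian v u) /=; ring.
have cs : l2inner u v <= l2norm u * l2norm v.
  rewrite -sqrtrM ?l2inner_ge0//; apply: le_trans (ler_norm _) _.
  rewrite -sqrtr_sqr ler_wsqrtr//.
  have [->|/l2inner_gt0 u_gt0] := eqVneq u 0.
    have l0 w : l2inner 0 w = 0 by rewrite linear0l.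
    by rewrite !l0 expr0n mul0r.
  have := l2inner_ge0 ((- (l2inner u v / l2inner u u)) *: u + v).
  rewrite expand -(pmulr_rge0 _ u_gt0) => h; rewrite -subr_ge0.
  suff -> : l2inner u u * l2inner v v - l2inner u v ^+ 2 = l2inner u u *
      ((- (l2inner u v / l2inner u u)) ^+ 2 * l2inner u u +
      2 * - (l2inner u v / l2inner u u) * l2inner u v + l2inner v v) by [].
  by field; rewrite gt_eqF.
have s0 := sqrtr_ge0 (l2inner u u); have s0' := sqrtr_ge0 (l2inner v v).
rewrite -(@ler_pXn2r _ 2) ?nnegrE ?sqrtr_ge0 ?addr_ge0//.
rewrite sqr_sqrtr ?l2inner_ge0// -{1 2}[u]scale1r expand sqrrD.
rewrite !sqr_sqrtr ?l2inner_ge0// -mulr_natl; lra.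
Qed.

Fact l2normZ (a : R) (u : l2prod X Y) : l2norm (a *: u) = `|a| * l2norm u.
Proof.
rewrite /l2norm linearZl /= linearZr /= mulrA sqrtrM ?sqr_ge0 -?expr2 ?sqr_ge0//.
by rewrite sqrtr_sqr.
Qed.

Fact l2norm0_eq0 (u : l2prod X Y) : l2norm u = 0 -> u = 0.
Proof.
move=> /eqP; rewrite sqrtr_eq0 => u0; apply/eqP/negPn/negP => /l2inner_gt0.
by rewrite ltNge u0.
Qed.

HB.instance Definition _ := @Lmodule_isNormed.Build R (l2prod X Y) l2norm
  l2norm_triangle l2normZ l2norm0_eq0.

HB.instance Definition _ := @NormedModule_isInnerProduct.Build R (l2prod X Y)
  l2inner (fun=> erefl).

End L2Prod.

Section VariationalAnalysis.
Context (R : realType).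
Local Open Scope ereal_scope.

Definition proper_efun (T : Type) (f : T -> \bar R) :=
  (forall x, -oo < f x) /\ (exists x, f x < +oo).

Context (E : euclideanType R).
Implicit Types (h : E -> \bar R) (x v : E).

(* Regular (Fréchet) subdifferential. If E = {0} the punctured neighbourhoods
   are empty, the lower limit is +oo, and every v qualifies. *)
Definition regular_subdiff h x : set E := [set v | h x \is a fin_num /\
  0 <= limf_einf
    (fun y => (h y - h x - (inner v (y - x)%R)%:E) * (`|y - x|^-1)%:E) x^'].

(* Limiting (Mordukhovich) subdifferential. *)
Definition limiting_subdiff h x : set E := [set v | h x \is a fin_num /\
  exists (xk vk : nat -> E),
    [/\ xk @ \oo --> x, h \o xk @ \oo --> h x,
        (forall k, regular_subdiff h (xk k) (vk k)) & vk @ \oo --> v]].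

Definition dom_subdiff h : set E := [set x | limiting_subdiff h x !=set0].

(* +oo when S is empty. *)
Definition dist x (S : set E) : \bar R := ereal_inf [set (`|x - v|)%:E | v in S].

Definition KL_at (theta : R) h (xbar : E) :=
  exists (eta : \bar R) (U : set E) (c : R),
    [/\ 0 < eta, nbhs xbar U, (0 < c)%R &
      let phi := fun t : R => (c * t `^ (1 - theta))%R in
      forall x, U x -> h xbar < h x < h xbar + eta ->
        1 <= (derive1 phi (fine (h x - h xbar)))%:E * dist 0%R (limiting_subdiff h x)].

Definition KL_function (theta : R) h :=
  forall xbar, dom_subdiff h xbar -> KL_at theta h xbar.

End VariationalAnalysis.

(* Largest maximiser of j |-> Phi (x j) over k - m <= j <= k; truncated
   subtraction gives max(0, k - m). *)
Definition ell (R : realType) (T : Type) (Phi : T -> \bar R) (x : nat -> T)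
    (m k : nat) : nat :=
  \max_(k - m <= j < k.+1 |
    all (fun i => (Phi (x i) <= Phi (x j))%E) (index_iota (k - m) k.+1)) j.

(* Main.v *)
Require Import Defs.
From HB Require Import structures.
From mathcomp Require Import all_boot all_order all_algebra.
From mathcomp Require Import all_classical all_reals all_analysis.
From mathcomp Require Import ring lra zify.

Set Implicit Arguments.
Unset Strict Implicit.
Unset Printing Implicit Defensive.

Import Order.TTheory GRing.Theory Num.Theory.
Import numFieldNormedType.Exports.

Local Open Scope classical_set_scope.
Local Open Scope ring_scope.

(** Let [F k = Phi (x (l k))] be the window maximum, [d k = |x k - x (k-1)|] the
    step length and [p = m + 1].  By (a), [F] decreases to some [om].

    Step lengths are controlled by decrements of [F].  If [l (k-1) < i < l k],
    then (a) gives [sqrt a * d i <= sqrt (F (i-1) - Phi (x i))], which is at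
    most [sqrt (F (k-p) - F k) + sqrt (F k - Phi (x i))], and (d) bounds the
    second root by [tau * sqrt a * d i] plus a multiple of the later steps up
    to [l k].  As [tau < 1] the term in [d i] is absorbed; at [i = l k]
    condition (a) suffices, and there are at most [m] indices to descend
    through.  Hence [d i <= C * sqrt (F (i-p) - F (i+p))] for all large [i]
    ([step_length]).

    The KL inequality is used at the points [z (l k)] only.  There [Theta] is
    squeezed between [F k] and [F (l k - 1) + vs (l k - 1)], which both tend to
    [om].  Condition (b) and the bound [Theta >= Phi] on cluster points force
    [Theta = om] at every cluster point of these points, and [0] is a limiting
    subgradient there because the subdifferential has a closed graph.  If no
    constant [C] made [(F k - om)^theta <= C * d (l k)] hold for all large [k]
    with [F k > om], violations with constants tending to infinity would have a
    subsequence converging to such a cluster point, against the KL property at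
    that point ([KL_along_sequence]).  With (a), [D k = F k - om] satisfies
    [D (k+p)^theta <= C * sqrt (D k - D (k+p))] whenever [D (k+p) > 0].

    If [theta = 0], the left-hand side [1] contradicts [d (l k) -> 0], so
    [F k = om] eventually, and then all later steps vanish by the bound on step
    lengths.  If [theta > 0], concavity of [t^(1-theta)] makes the decrements
    [sqrt (D k - D (k+p))] summable, with tails bounded by
    [sqrt (D n) + (D n)^(1-theta)] ([sum_KL_gaps_le]); the recurrence squared
    makes [D] decay linearly when [theta <= 1/2], and makes [D^(2 theta - 1)]
    decay like [1/k] when [theta > 1/2] ([KL_rate]).  Either way the steps are
    summable, and the tails bound the distance to a cluster point of [x], which
    exists since [z] is bounded ([cvg_of_summable_steps]). *)

(** * Subsequences *)

Lemma increasing_seq_comp (s t : nat -> nat) :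
  increasing_seq s -> increasing_seq t -> increasing_seq (s \o t).
Proof. by move=> hs ht i j; rewrite /= hs. Qed.

Lemma increasing_seq_ge_id (s : nat -> nat) n : increasing_seq s -> (n <= s n)%N.
Proof.
move=> /increasing_seqP hs; elim: n => // n ih.
by apply: leq_ltn_trans ih _; have := hs n.
Qed.

(** The hypothesis is [n <= s n] rather than monotonicity because index
    sequences such as [k |-> l (k + m + 1) - 1] may stall. *)
Lemma cvgn_subseq (T : topologicalType) (u : nat -> T) (s : nat -> nat) (l : T) :
  (forall n, (n <= s n)%N) -> u @ \oo --> l -> (u \o s) @ \oo --> l.
Proof.
move=> hs; apply: cvg_comp => A [N _ NA]; exists N => // k /= Nk; apply: NA => /=.
exact: leq_trans Nk _.
Qed.

Lemma increasing_seq_choice (P : nat -> nat -> Prop) :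
  (forall K n, exists2 k, (K <= k)%N & P n k) ->
  exists2 s : nat -> nat, increasing_seq s & forall n, P n (s n).
Proof.
move=> ex.
have ex2 (Kn : nat * nat) : exists k, (Kn.1 <= k)%N /\ P Kn.2 k.
  by have [k] := ex Kn.1 Kn.2; exists k.
have [g gP] := choice ex2.
pose s := fix s n := if n is n'.+1 then g ((s n').+1, n) else g (0%N, 0%N).
exists s; last first.
  by case=> [|n]; [have [] := gP (0, 0)%N|have [] := gP ((s n).+1, n.+1)].
by apply/increasing_seqP => n /=; have [] := gP ((s n).+1, n.+1).
Qed.

(** * Bounded sequences in Euclidean spaces *)

Section Euclidean.
Context (R : realType) (E : euclideanType R).
Implicit Types u v : E.

Lemma inner_ge0 u : 0 <= inner u u.
Proof. by have [->|/inner_gt0/ltW//] := eqVneq u 0; rewrite linear0l. Qed.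

Lemma sqr_norm u : `|u| ^+ 2 = inner u u.
Proof. by rewrite normr_inner sqr_sqrtr// inner_ge0. Qed.

Lemma inner_le_norm u v : inner u v <= `|u| * `|v|.
Proof.
have : `|u + v| ^+ 2 <= (`|u| + `|v|) ^+ 2.
  by rewrite ler_pXn2r ?nnegrE ?addr_ge0// ler_normD.
rewrite sqrrD !sqr_norm -[X in inner (X + _)]scale1r inner_linearl.
rewrite -[X in inner _ (X + _)]scale1r -[X in inner v (X + _)]scale1r.
rewrite !inner_linearr (innerC v u) -mulr_natl; lra.
Qed.

Lemma ler_abs_inner u v : `|inner u v| <= `|u| * `|v|.
Proof.
rewrite ler_norml inner_le_norm andbT lerNl -(normrN u).
by rewrite -linearNl inner_le_norm.
Qed.

(** Takes the place of an orthonormal basis: the inner products with a basis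
    determine a vector, so the linear map [v |-> (inner v (e i))_i] has a left
    inverse, and [g] is the image of the canonical basis under it. *)
Lemma inner_frame : exists (n : nat) (e g : 'I_n -> E),
  forall v, v = \sum_i inner v (e i) *: g i.
Proof.
pose n := \dim {:E}; pose e i := (vbasis {:E})`_i.
pose f := fun v => \row_(i < n) inner v (e i).
have fL : linear f.
  by move=> a u v; apply/rowP => i; rewrite !mxE inner_linearl.
pose fl : {linear E -> 'rV[R]_n} := HB.pack f (GRing.isLinear.Build _ _ _ _ f fL).
have flE v : linfun fl v = f v by rewrite lfunE.
have kf : lker (linfun fl) == 0%VS.
  rewrite -subv0; apply/subvP => v; rewrite memv_ker memv0 flE => /eqP fv0.
  apply: contraT => /inner_gt0; suff -> : inner v v = 0 by rewrite ltxx.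
  rewrite [X in inner _ X](coord_vbasis (memvf v)) linear_sumr big1// => i _.
  rewrite linearZr/= (_ : inner v _ = 0) ?mulr0//.
  by have /rowP/(_ i) := fv0; rewrite !mxE.
exists n, (fun i => e i), (fun i => ((linfun fl)^-1)%VF (delta_mx 0 i)) => v.
rewrite -[LHS](lker0_lfunK kf) flE [f v]row_sum_delta linear_sum.
by apply: eq_bigr => i _; rewrite linearZ/= mxE.
Qed.

(** One coordinate at a time, refining the subsequence by the real
    Bolzano-Weierstrass theorem. *)
Lemma bounded_subseq_inner n (e : 'I_n -> E) (u : nat -> E) (M : R) :
  (forall k, `|u k| <= M) ->
  exists2 s : nat -> nat, increasing_seq s &
    forall i, cvgn (fun k => inner (u (s k)) (e i)).
Proof.
move=> uM; elim: n e => [|n IH] e.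
  by exists id => // -[].
have [s hs hc] := IH (fun i => e (lift ord0 i)).
have [|t ht hct] := @bolzano_weierstrass R (fun k => inner (u (s k)) (e ord0)).
  exists (M * `|e ord0|); split; first exact: num_real.
  move=> y My k _; apply: le_trans (ler_abs_inner _ _) _.
  by apply: le_trans (ltW My); exact: ler_wpM2r.
exists (s \o t); first exact: increasing_seq_comp.
move=> i; have [j ->|->//] := unliftP ord0 i.
have /cvg_ex[l hl] := hc j; apply/cvg_ex; exists l.
by apply: (cvgn_subseq _ hl) => k; exact: increasing_seq_ge_id.
Qed.

Lemma euclidean_bolzano_weierstrass (u : nat -> E) (M : R) :
  (forall k, `|u k| <= M) ->
  exists (s : nat -> nat) (l : E),
    increasing_seq s /\ (u \o s) @ \oo --> l.
Proof.
move=> uM; have [n [e [g fr]]] := inner_frame.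
have [s hs hc] := bounded_subseq_inner e uM.
exists s, (\sum_i lim ((fun k => inner (u (s k)) (e i)) @ \oo) *: g i).
split=> //.
rewrite [X in X @ _](_ : _ = fun k => \sum_i inner (u (s k)) (e i) *: g i).
  apply: cvg_big => [|i _]; last by apply: cvgZr_tmp; exact: hc.
  exact: add_continuous.
by apply/funext => k /=; rewrite -fr.
Qed.

End Euclidean.

Lemma norm_fst_l2prod (R : realType) (X Y : euclideanType R) (u : l2prod X Y) :
  `|u.1| <= `|u|.
Proof.
rewrite !normr_inner ler_wsqrtr// [leRHS]/(l2inner u u) /l2inner.
by rewrite lerDl inner_ge0.
Qed.

Lemma cvg_fst_l2prod (R : realType) (X Y : euclideanType R)
    (u : nat -> l2prod X Y) (l : l2prod X Y) :
  u @ \oo --> l -> (fun k => (u k).1) @ \oo --> l.1.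
Proof.
move=> /cvgrPdist_lt ul; apply/cvgrPdist_lt => e e0.
near=> k; apply: le_lt_trans (norm_fst_l2prod (l - u k)) _.
by near: k; exact: ul.
Unshelve. all: by end_near. Qed.

(** * Limiting subdifferentials and the KL inequality *)

Section Subdifferential.
Context (R : realType) (E : euclideanType R).
Implicit Types (h : E -> \bar R) (x v : E).

Lemma cvgn_close (V : normedModType R) (u w : nat -> V) (l : V) :
  (forall k, `|u k - w k| < k.+1%:R^-1) -> u @ \oo --> l -> w @ \oo --> l.
Proof.
move=> uw ul.
have uw0 : (fun k => u k - w k) @ \oo --> (0 : V).
  apply/cvgrPdist_lt => e e0; near=> k; rewrite sub0r normrN.
  apply: lt_trans (uw k) _; near: k; exact: near_infty_natSinv_lt (PosNum e0).
rewrite -[l]subr0 (_ : w = fun k => u k - (u k - w k)); first exact: cvgB.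
by apply/funext => k; rewrite opprB addrC subrK.
Unshelve. all: by end_near. Qed.

(** The graph of the limiting subdifferential is closed under convergence of
    points, values and subgradients: each [v k] is itself a limit of regular
    subgradients, and a diagonal choice within [1/(k+1)] converges to [w]. *)
Lemma limiting_subdiff_closed h (z v : nat -> E) x w :
  h x \is a fin_num -> z @ \oo --> x -> h \o z @ \oo --> h x ->
  (forall k, limiting_subdiff h (z k) (v k)) -> v @ \oo --> w ->
  limiting_subdiff h x w.
Proof.
move=> hx zx hzx zv vw; split=> //.
have approx k : exists yw : E * E, [/\ regular_subdiff h yw.1 yw.2,
    `|z k - yw.1| < k.+1%:R^-1, `|v k - yw.2| < k.+1%:R^-1 &
    `|fine (h (z k)) - fine (h yw.1)| < k.+1%:R^-1].
  have [hz [y [u [yz hyz reg uv]]]] := zv k.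
  have k0 : 0 < k.+1%:R^-1 :> R by rewrite invr_gt0.
  near \oo => n; exists (y n, u n); split => //=.
  - by near: n; move/cvgrPdist_lt: yz; exact.
  - by near: n; move/cvgrPdist_lt: uv; exact.
  - near: n; have : fine (h (y n)) @[n --> \oo] --> fine (h (z k)).
      by apply: fine_cvg; rewrite fineK.
    by move/cvgrPdist_lt; exact.
have [yw /all_and4[reg zy vu hzy]] := choice approx.
exists (fun k => (yw k).1), (fun k => (yw k).2); split => //.
- exact: cvgn_close zx.
- have fh k : h (yw k).1 \is a fin_num by have [] := reg k.
  rewrite (_ : h \o _ = fun k => (fine (h (yw k).1))%:E); last first.
    by apply/funext => k /=; rewrite fineK.
  rewrite -(fineK hx); apply: cvg_EFin; first exact: nearW.
  apply: (cvgn_close hzy); apply: fine_cvg; by rewrite fineK.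
- exact: cvgn_close vw.
Unshelve. all: by end_near. Qed.

Lemma dist_lt_ex x (S : set E) (r : R) :
  (dist x S < r%:E)%E -> exists2 v, S v & `|x - v| < r.
Proof.
by move=> /ereal_inf_lt[_ [v Sv <-]]; rewrite lte_fin; exists v.
Qed.

(** The KL inequality solved for the gap [t = h y - h x]: with the
    desingularising function [c * t^(1-theta)], whose derivative is
    [c * (1-theta) * t^(-theta)], it reads [t^theta <= c * (1-theta) * dist]. *)
Lemma KL_at_powR (theta : R) h x :
  0 <= theta < 1 -> h x \is a fin_num -> KL_at theta h x ->
  exists (eta c : R), [/\ 0 < eta, 0 < c & \forall y \near x, forall t d : R,
    h y = (fine (h x) + t)%:E -> 0 < t < eta ->
    (dist 0%R (limiting_subdiff h y) <= d%:E)%E -> t `^ theta <= c * d].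
Proof.
move=> /andP[th0 th1] hx [eta [U [c [eta0 Ux c0 KL]]]].
have [e e0 le_eta] : exists2 e : R, 0 < e & (e%:E <= eta)%E.
  case: eta eta0 {KL} => [e e0|_|//]; first by exists e.
  by exists 1 => //; rewrite leey.
exists e, (c * (1 - theta)); split => //; first by rewrite mulr_gt0// subr_gt0.
near=> y => t d hy /andP[t0 te] dy.
have /KL : U y by near: y.
have -> : fine (h y - h x) = t.
  by rewrite hy -[h x in LHS](fineK hx) -EFinD/=; ring.
have -> : (h x < h y < h x + eta)%E.
  rewrite hy -(fineK hx) lte_fin ltrDl t0 EFinD lteD2lE ?fin_numE//=.
  by apply: lt_le_trans le_eta; rewrite lte_fin.
move=> /(_ isT).
have := is_derive1_powR (1 - theta) t0 => ?.
rewrite derive1E derive_val /= (_ : 1 - theta - 1 = - theta); last by ring.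
set D := (c *: _); move=> le1.
have tp : 0 < t `^ theta by rewrite powR_gt0.
have DE : D = c * (1 - theta) / t `^ theta.
  by rewrite /D [LHS]/GRing.scale/= powRN mulrA.
have D0 : 0 <= D by rewrite DE !mulr_ge0 ?invr_ge0 ?ltW// subr_gt0.
have : (1 <= D%:E * d%:E)%E.
  by apply: le_trans le1 _; rewrite lee_wpmul2l// lee_fin.
rewrite -EFinM lee_fin DE mulrAC ler_pdivlMr// mul1r.
by [].
Unshelve. all: by end_near. Qed.

End Subdifferential.

(** * Step lengths of nonmonotone descent *)

Lemma bigmax_nat_mem (s : seq nat) (P : pred nat) :
  has P s -> P (\max_(j <- s | P j) j) /\ \max_(j <- s | P j) j \in s.
Proof.
elim: s => // j s IH /=; rewrite big_cons inE.
have [/IH[Ps sin] _|/hasPn nPs] := boolP (has P s).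
  case: (boolP (P j)) => Pj; last by rewrite sin orbT.
  by rewrite /maxn; case: ifP => _; rewrite ?Ps ?sin ?Pj ?eqxx ?orbT.
rewrite orbF => Pj; rewrite Pj big_seq_cond big1 ?maxn0 ?eqxx//.
by move=> i /andP[/nPs/negP].
Qed.

Section Ell.
Context (R : realType) (T : Type) (Phi : T -> \bar R) (x : nat -> T) (m : nat).
Local Notation l := (ell Phi x m).

Lemma ellP k : (k - m <= l k <= k)%N /\
  forall i, (k - m <= i <= k)%N -> (Phi (x i) <= Phi (x (l k)))%E.
Proof.
set w := index_iota (k - m) k.+1.
set P := fun j => all (fun i => (Phi (x i) <= Phi (x j))%E) w.
have winE i : (i \in w) = (k - m <= i <= k)%N by rewrite mem_index_iota ltnS.
have hP : has P w.
  have i0 : (k - m <= @ord_max k <= k)%N by rewrite leq_subr leqnn.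
  case: (@arg_maxP _ _ _ (@ord_max k) (fun i : 'I_k.+1 => k - m <= i <= k)%N
    (fun i => Phi (x i)) i0) => i iw imax.
  apply/hasP; exists (nat_of_ord i); first by rewrite winE.
  apply/allP => j; rewrite winE => jw.
  by apply: (imax (@Ordinal k.+1 j _)) => //; rewrite ltnS; case/andP: jw.
have [Pl lin] := bigmax_nat_mem hP; split; first by rewrite -winE.
by move=> i; rewrite -winE => /(allP Pl).
Qed.

End Ell.

Lemma sqrtr_subadd (R : rcfType) (u v : R) : 0 <= u -> 0 <= v ->
  Num.sqrt (u + v) <= Num.sqrt u + Num.sqrt v.
Proof.
move=> u0 v0; rewrite -(@ler_pXn2r _ 2) ?nnegrE ?addr_ge0 ?sqrtr_ge0//.
rewrite sqrrD !sqr_sqrtr ?addr_ge0// -mulr_natl.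
have := mulr_ge0 (sqrtr_ge0 u) (sqrtr_ge0 v); lra.
Qed.

(* [f], [d] and [l] abstract [Phi (x k)], the norm of [x k - x k.-1] and
   [ell Phi x m]. *)
Section StepLength.
Context (R : realType) (f d : nat -> R) (l : nat -> nat) (m kbar : nat).
Context (a tau mu : R).
Hypothesis a_gt0 : 0 < a.
Hypothesis d_ge0 : forall k, 0 <= d k.
Hypothesis l_window : forall k, (k - m <= l k <= k)%N.
Hypothesis l_max : forall k i, (k - m <= i <= k)%N -> f i <= f (l k).
Hypothesis descent : forall k, f k.+1 + a * d k.+1 ^+ 2 <= f (l k).

Let F k := f (l k).

Lemma window_max_nonincreasing : {homo F : i j / (i <= j)%N >-> j <= i}.
Proof.
apply/nonincreasing_seqP => k; rewrite /F.
have /andP[] := l_window k.+1; rewrite (leq_eqVlt (l k.+1)) => l1 /predU1P[->|lk].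
  by apply: le_trans (descent k); rewrite lerDl mulr_ge0 ?sqr_ge0 ?ltW.
by apply: l_max; lia.
Qed.

Lemma descent_step i : (0 < i)%N ->
  Num.sqrt a * d i <= Num.sqrt (F i.-1 - f i).
Proof.
case: i => // i _ /=.
have -> : Num.sqrt a * d i.+1 = Num.sqrt (a * d i.+1 ^+ 2).
  by rewrite sqrtrM ?ltW// sqrtr_sqr ger0_norm.
by apply: ler_wsqrtr; rewrite lerBrDl descent.
Qed.

Hypothesis tau_lt1 : 0 < tau < 1.
Hypothesis mu_gt0 : 0 < mu.
Hypothesis kbar_gt : (m < kbar)%N.
Hypothesis in_between : forall k, (kbar <= k)%N ->
  forall i, (l (k - 1) + 1 <= i <= l k - 1)%N ->
  Num.sqrt (F k - f i) <=
    tau * Num.sqrt a * d i + mu * \sum_(i + 1 <= j < (l k).+1) d j.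

(** Induction on the number [n] of indices below [l k].  At [i = l k] the
    descent condition bounds [d i] by [sqrt (F (k - m.+1) - F k)]; below it,
    [in_between] bounds [d i] by the same root and the sum over later indices,
    the share [tau < 1] of [d i] itself being absorbed on the left. *)
Lemma sum_steps_le n : exists2 A : R, 0 <= A &
  forall k i, (kbar <= k)%N -> (l (k - 1) < i <= l k)%N -> (l k <= i + n)%N ->
    \sum_(i <= j < (l k).+1) d j <= A * Num.sqrt (F (k - m.+1) - F k).
Proof.
have [tau0 tau1] := andP tau_lt1.
have sa0 : 0 < Num.sqrt a by rewrite sqrtr_gt0.
have c0 : 0 < (1 - tau) * Num.sqrt a by rewrite mulr_gt0// subr_gt0.
pose al := ((1 - tau) * Num.sqrt a)^-1.
have al0 : 0 < al by rewrite invr_gt0.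
have F_prev k i : (kbar <= k)%N -> (l (k - 1) < i <= l k)%N ->
    0 <= F i.-1 - F k <= F (k - m.+1) - F k.
  move=> kk /andP[i1 i2]; have /andP[w1 w2] := l_window (k - 1).
  have /andP[w3 w4] := l_window k.
  rewrite subr_ge0 lerD2r; apply/andP.
  split; apply: window_max_nonincreasing; clear -i1 i2 w1 w4; lia.
have at_top k i : (kbar <= k)%N -> (l (k - 1) < i <= l k)%N -> i = l k ->
    d i <= al * Num.sqrt (F (k - m.+1) - F k).
  move=> kk hi ilk; have /andP[F0 F1] := F_prev _ _ kk hi.
  have := @descent_step i; rewrite (leq_ltn_trans _ (andP hi).1)//= => /(_ isT) h.
  rewrite ler_pdivlMl//; apply: le_trans (_ : Num.sqrt a * d i <= _).
    by rewrite -mulrA ler_piMl ?mulr_ge0 ?(ltW sa0)//; lra.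
  by apply: le_trans h _; apply: ler_wsqrtr; rewrite [in f i]ilk.
elim: n => [|n [A A0 IH]].
  exists al; first exact: ltW.
  move=> k i kk hi ile; have ilk : i = l k by case/andP: hi => _ i2; lia.
  by rewrite ilk big_nat1 -ilk at_top.
exists (al + (al * mu + 1) * A) => [|k i kk hi ile].
  by rewrite addr_ge0 ?mulr_ge0 ?addr_ge0 ?mulr_ge0// ltW.
have S0 := sqrtr_ge0 (F (k - m.+1) - F k).
have [eq|ne] := eqVneq i (l k).
  rewrite eq big_nat1 -eq; apply: le_trans (at_top _ _ kk hi eq) _.
  by rewrite ler_wpM2r// lerDl mulr_ge0 ?addr_ge0 ?mulr_ge0// ltW.
have [i1 i2] := andP hi.
have ilt : (i < l k)%N by rewrite ltn_neqAle ne.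
rewrite big_ltn; last by rewrite ltnS ltnW.
have tail : \sum_(i.+1 <= j < (l k).+1) d j <= A * Num.sqrt (F (k - m.+1) - F k).
  by apply: IH => //; [rewrite ilt andbT ltnW|rewrite addSnnS].
set T := \sum_(i.+1 <= j < _) _ in tail *.
suff di : d i <= al * (Num.sqrt (F (k - m.+1) - F k) + mu * T).
  apply: le_trans (lerD di (lexx _)) _.
  rewrite mulrDr -addrA mulrDl lerD2l mulrA -[X in _ + X]mul1r -mulrDl -mulrA.
  by rewrite ler_wpM2l ?addr_ge0 ?mulr_ge0// ltW.
rewrite ler_pdivlMl//.
have := @descent_step i; rewrite (leq_ltn_trans _ i1)//= => /(_ isT) h1.
have h2 : Num.sqrt (F k - f i) <= tau * Num.sqrt a * d i + mu * T.
  rewrite /T -addn1; apply: in_between => //.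
  by rewrite addn1 i1 -ltnS subn1 prednK// (leq_ltn_trans _ ilt).
have /andP[F0 F1] := F_prev _ _ kk hi.
have h3 : Num.sqrt (F i.-1 - f i) <=
    Num.sqrt (F (k - m.+1) - F k) + Num.sqrt (F k - f i).
  rewrite (_ : F i.-1 - f i = (F i.-1 - F k) + (F k - f i)); last by ring.
  apply: le_trans (sqrtr_subadd F0 _) _; last by rewrite lerD2r ler_wsqrtr.
  rewrite subr_ge0; apply: l_max.
  have /andP[w1 w2] := l_window (k - 1); have /andP[w3 w4] := l_window k.
  by clear -i1 i2 w1 w4; lia.
lra.
Qed.

(** Every [i >= kbar] lies in [l (k-1) < i <= l k] for the least [k] with
    [i <= l k].  This range has at most [m + 1] indices, as
    [l (k-1) >= k - 1 - m], and [i <= k <= i + m] lets the monotonicity of [F]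
    replace [k] by [i]. *)
Lemma step_length : exists2 C : R, 0 <= C & forall i, (kbar <= i)%N ->
  d i <= C * Num.sqrt (F (i - m.+1) - F (i + m.+1)).
Proof.
have [C C0 HC] := sum_steps_le m.
exists C => // i ki.
have ex : exists k, (i <= l k)%N.
  by exists (i + m)%N; have /andP[] := l_window (i + m); lia.
case: (ex_minnP ex) => k ik kmin.
have /andP[w1 w2] := l_window k.
have kk : (kbar <= k)%N by lia.
have kim : (k <= i + m)%N.
  by apply: kmin; have /andP[] := l_window (i + m); lia.
have i1 : (l (k - 1) < i)%N.
  rewrite ltnNge; apply/negP => /kmin; lia.
have /andP[w3 w4] := l_window (k - 1).
have := HC k i kk; rewrite i1 ik => /(_ isT) /(_ ltac:(lia)) h.
apply: le_trans (_ : C * Num.sqrt (F (k - m.+1) - F k) <= _).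
  apply: le_trans h; rewrite big_ltn; last by lia.
  by rewrite lerDl sumr_ge0.
rewrite ler_wpM2l// ler_wsqrtr//; apply: lerB; apply: window_max_nonincreasing; lia.
Qed.

End StepLength.

(** * Rates from the discrete KL inequality *)

Section Rates.
Context (R : realType).
Implicit Types (D w : nat -> R) (u v theta : R).

Lemma nat_step_ind (P : nat -> Prop) (K p : nat) : (0 < p)%N ->
  (forall k, (K <= k < K + p)%N -> P k) ->
  (forall k, (K <= k)%N -> P k -> P (k + p)%N) ->
  forall k, (K <= k)%N -> P k.
Proof.
move=> p0 base step k; elim/ltn_ind: k => k IH Kk.
have [kp|pk] := ltnP k (K + p); first by apply: base; rewrite Kk.
by rewrite -(@subnK p k); [apply: step; [lia|apply: IH; lia]|lia].
Qed.

(** A contraction over [p] steps is a contraction [rho] per step as soon as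
    [q <= rho^p]; Bernoulli's inequality gives this for
    [rho = 1 - (1 - q) / p] without extracting a root. *)
Lemma linear_rate D (K p : nat) (q : R) : (0 < p)%N -> 0 < q < 1 ->
  (forall k, 0 <= D k) -> {homo D : i j / (i <= j)%N >-> j <= i} ->
  (forall k, (K <= k)%N -> D (k + p)%N <= q * D k) ->
  exists M rho : R, [/\ 0 < M, 0 < rho < 1 &
    forall k, (K <= k)%N -> D k <= M * rho ^+ k].
Proof.
move=> p0 /andP[q0 q1] D0 Dle step.
have pR : 1 <= p%:R :> R by rewrite ler1n.
have pR0 : 0 < p%:R :> R by rewrite ltr0n.
pose rho : R := 1 - (1 - q) / p%:R.
have h1 : (1 - q) / p%:R <= 1 - q by rewrite ler_pdivrMr// ler_peMr// subr_ge0 ltW.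
have h2 : 0 < (1 - q) / p%:R by rewrite divr_gt0// subr_gt0.
have rho0 : 0 < rho by rewrite /rho; lra.
have rho1 : rho < 1 by rewrite /rho; lra.
have bern : q <= rho ^+ p.
  suff : forall n, 1 - n%:R * (1 - rho) <= rho ^+ n.
    move=> /(_ p); apply: le_trans; rewrite /rho opprB addrCA subrr addr0.
    by rewrite mulrC divfK ?gt_eqF// opprB addrCA subrr addr0.
  elim=> [|n IH]; first by rewrite mul0r subr0 expr0.
  rewrite exprS; apply: le_trans (_ : rho * (1 - n%:R * (1 - rho)) <= _).
    have := mulr_ge0 (ler0n R n) (sqr_ge0 (1 - rho)).
    by rewrite -[n.+1]addn1 natrD expr2; nra.
  by rewrite ler_wpM2l// ltW.
pose M := (D K + 1) / rho ^+ (K + p); exists M, rho; split; last 2 first.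
- by rewrite rho0.
- apply: (nat_step_ind p0) => [k /andP[Kk kp]|k Kk Dk].
    apply: le_trans (Dle _ _ Kk) _; rewrite /M mulrAC ler_pdivlMr ?exprn_gt0//.
    apply: le_trans (_ : (D K + 1) * rho ^+ (K + p) <= _).
      by rewrite ler_wpM2r ?exprn_ge0 ?(ltW rho0)// lerDl.
    rewrite ler_wpM2l ?addr_ge0//.
    by apply: ler_wiXn2l; rewrite ?(ltW rho0) ?(ltW rho1)// ltnW.
  apply: le_trans (step _ Kk) _; rewrite [in leRHS]exprD [leRHS]mulrA.
  rewrite [leRHS]mulrC.
  by apply: ler_pM => //; exact: ltW.
- by rewrite /M divr_gt0 ?exprn_gt0// ltr_wpDl.
Qed.

(** The recurrence says that [1 / w] grows by at least [kap] every [p] steps;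
    it is stated without inverses so that [w] may vanish. *)
Lemma sublinear_rate w (K p : nat) (kap : R) : (0 < p)%N -> 0 < kap ->
  (forall k, 0 <= w k) ->
  (forall k, (K <= k)%N -> w (k + p)%N * (1 + kap * w k) <= w k) ->
  forall k, (K <= k)%N -> kap * (k%:R - (K + p)%:R) * w k <= p%:R.
Proof.
move=> p0 kap0 w0 step; apply: (nat_step_ind p0) => [k /andP[Kk kp]|k Kk wk].
  apply: le_trans (_ : 0 <= _) => //; rewrite mulr_le0_ge0// mulr_ge0_le0 ?(ltW kap0)//.
  by rewrite subr_le0 ler_nat ltnW.
have s0 : 0 < 1 + kap * w k by rewrite ltr_wpDr ?mulr_ge0 ?(ltW kap0).
rewrite -(ler_pM2r s0) -[leLHS]mulrA.
have [kK|kK] := leP (K%:R : R) k%:R; last by move: kK; rewrite ltr_nat ltnNge Kk.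
apply: le_trans (_ : kap * ((k + p)%:R - (K + p)%:R) * w k <= _).
  by rewrite ler_wpM2l ?step// mulr_ge0 ?(ltW kap0)// subr_ge0 ler_nat leq_add2r.
by move: wk; rewrite !natrD; lra.
Qed.

Lemma weighted_am_gm u v theta : 0 < theta < 1 -> 0 <= u -> 0 <= v ->
  u `^ theta * v `^ (1 - theta) <= theta * u + (1 - theta) * v.
Proof.
move=> /andP[t0 t1] u0 v0; have t10 : 0 < 1 - theta by rewrite subr_gt0.
have := @conjugate_powR R (u `^ theta) (v `^ (1 - theta)) theta^-1 (1 - theta)^-1
  (powR_ge0 _ _) (powR_ge0 _ _).
rewrite !invr_gt0 t0 t10 !invrK subrKC => /(_ isT isT erefl).
rewrite -!powRrM !divff ?gt_eqF// !powRr1//; lra.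
Qed.

(** The tangent inequality for [t^(1-theta)] at [u], cleared of [u^(-theta)]. *)
Lemma powR_concave u v theta : 0 < theta < 1 -> 0 <= u -> 0 <= v ->
  (1 - theta) * (u - v) <= u `^ theta * (u `^ (1 - theta) - v `^ (1 - theta)).
Proof.
move=> th u0 v0; have [t0 t1] := andP th.
have := weighted_am_gm th u0 v0.
rewrite [u `^ _ * (_ - _)]mulrBr -powRD subrKC ?powRr1 ?oner_eq0//; lra.
Qed.

(** Telescoping with lag [p]: only the first [p] terms survive with a positive
    sign. *)
Lemma sum_shift_le (g : nat -> R) (M : R) (n N p : nat) :
  (forall k, (n <= k)%N -> 0 <= g k <= M) ->
  \sum_(n <= k < N) (g k - g (k + p)%N) <= p%:R * M.
Proof.
move=> gM; have M0 : 0 <= M by have /andP[] := gM n (leqnn n); exact: le_trans.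
have [nN|Nn] := leqP n N; last by rewrite big_geq ?mulr_ge0// ltnW.
have -> : \sum_(n <= k < N) (g k - g (k + p)%N) =
    \sum_(n <= k < n + p) g k - \sum_(N <= k < N + p) g k.
  elim: N nN => [|N IH].
    by rewrite leqn0 => /eqP ->; rewrite big_geq// subrr.
  rewrite leq_eqVlt => /predU1P[<-|nN]; first by rewrite big_geq// subrr.
  rewrite big_nat_recr//= IH//.
  have h1 : \sum_(N <= k < N.+1 + p) g k = g N + \sum_(N.+1 <= k < N.+1 + p) g k.
    by rewrite big_ltn// addSn ltnS leq_addr.
  have h2 : \sum_(N <= k < N.+1 + p) g k = \sum_(N <= k < N + p) g k + g (N + p)%N.
    by rewrite addSn big_nat_recr//= leq_addr.
  by move: h1; rewrite h2; lra.
apply: le_trans (_ : \sum_(n <= k < n + p) g k <= _).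
  rewrite gerBl big_nat_cond sumr_ge0// => k /andP[/andP[Nk _] _].
  by have /andP[] := gM k (leq_trans nN Nk).
apply: le_trans (_ : \sum_(n <= k < n + p) M <= _).
  by apply: ler_sum_nat => k /andP[nk _]; have /andP[] := gM k nk.
by rewrite sumr_const_nat addKn mulr_natl.
Qed.

(* [D k] abstracts the excess of the window maximum over its limit. *)
Section KLRecurrence.
Context (D : nat -> R) (K p : nat) (theta C : R).
Hypothesis p_gt0 : (0 < p)%N.
Hypothesis theta01 : 0 < theta < 1.
Hypothesis C_gt0 : 0 < C.
Hypothesis D_ge0 : forall k, 0 <= D k.
Hypothesis D_le1 : forall k, (K <= k)%N -> D k <= 1.
Hypothesis D_homo : {homo D : i j / (i <= j)%N >-> j <= i}.
Hypothesis KL : forall k, (K <= k)%N ->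
  D (k + p)%N `^ theta <= C * Num.sqrt (D k - D (k + p)%N).

Let E k := Num.sqrt (D k - D (k + p)%N).
Let psi k := D k `^ (1 - theta).

Let dec k : 0 <= D k - D (k + p)%N.
Proof. by rewrite subr_ge0; apply: D_homo; exact: leq_addr. Qed.

Let t0 : 0 < theta. Proof. by case/andP: theta01. Qed.
Let t1 : 0 < 1 - theta. Proof. by rewrite subr_gt0; case/andP: theta01. Qed.

Lemma psi_homo : {homo psi : i j / (i <= j)%N >-> j <= i}.
Proof.
move=> i j ij; rewrite /psi; apply: ge0_ler_powR; rewrite ?nnegrE ?D_ge0 ?D_homo//.
exact: ltW.
Qed.

(** Concavity bounds [E (k+p)^2 = D (k+p) - D (k+2p)] by
    [D (k+p)^theta * (psi (k+p) - psi (k+2p)) / (1 - theta)].  The recurrence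
    replaces [D (k+p)^theta] by [C * E k], and the arithmetic-geometric mean
    inequality separates the product. *)
Lemma KL_half_step k : (K <= k)%N ->
  E (k + p)%N <= E k / 2 +
    C / (1 - theta) / 2 * (psi (k + p)%N - psi (k + p + p)%N).
Proof.
move=> Kk; set X := psi _ - psi _.
have X0 : 0 <= X by rewrite subr_ge0 psi_homo// leq_addr.
have E0 : 0 <= E k := sqrtr_ge0 _.
pose Y := C / (1 - theta) * X.
have Y0 : 0 <= Y by rewrite mulr_ge0// divr_ge0// ltW.
have sq : E (k + p)%N ^+ 2 <= E k * Y.
  rewrite sqr_sqrtr ?dec// -(ler_pM2l t1).
  apply: le_trans (powR_concave theta01 (D_ge0 _) (D_ge0 _)) _.
  rewrite -/(psi _) -/(psi (k + p + p)) -/X.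
  apply: le_trans (ler_wpM2r X0 (KL Kk)) _; rewrite -/(E k) /Y.
  rewrite le_eqVlt; apply/orP; left; apply/eqP; field; exact: lt0r_neq0.
have -> : E k / 2 + C / (1 - theta) / 2 * X = (E k + Y) / 2 by rewrite /Y; lra.
rewrite -(@ler_pXn2r _ 2) ?nnegrE ?sqrtr_ge0 ?divr_ge0 ?addr_ge0//.
apply: le_trans sq _; have := sqr_ge0 (E k - Y); rewrite !expr2; nra.
Qed.

(** [KL_half_step] rearranges to a bound of [E k] by [2 * (E k - E (k+p))] and a
    difference of [psi], and both telescope with lag [p]. *)
Lemma sum_KL_gaps_le : exists2 c : R, 0 < c & forall n N, (K <= n)%N ->
  \sum_(n <= k < N) E k <= c * (Num.sqrt (D n) + D n `^ (1 - theta)).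
Proof.
have pR : 0 < p%:R :> R by rewrite ltr0n.
have cc0 : 0 < C / (1 - theta) by rewrite divr_gt0.
exists (2 * p%:R + C / (1 - theta) * p%:R) => [|n N Kn].
  by rewrite addr_gt0 ?(mulr_gt0 cc0)// mulr_gt0.
have s0 := sqrtr_ge0 (D n); have q0 : 0 <= psi n := powR_ge0 _ _.
have hE : \sum_(n <= k < N) (E k - E (k + p)%N) <= p%:R * Num.sqrt (D n).
  apply: sum_shift_le => k nk; rewrite sqrtr_ge0/= ler_wsqrtr//.
  by rewrite lerBlDr -[leLHS]addr0 lerD ?D_homo.
have hp : \sum_(n <= k < N) (psi (k + p)%N - psi (k + p + p)%N) <= p%:R * psi n.
  apply: (sum_shift_le (g := fun k => psi (k + p)%N)) => k nk.
  by rewrite powR_ge0 psi_homo// (leq_trans nk)// leq_addr.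
apply: le_trans (_ : \sum_(n <= k < N) (2 * (E k - E (k + p)%N) +
    C / (1 - theta) * (psi (k + p)%N - psi (k + p + p)%N)) <= _).
  apply: ler_sum_nat => k /andP[nk _].
  by have := KL_half_step (leq_trans Kn nk); lra.
rewrite big_split/= -!mulr_sumr.
apply: le_trans (lerD (ler_wpM2l _ hE) (ler_wpM2l (ltW cc0) hp)) _ => //.
rewrite -/(psi n).
have := mulr_ge0 (ltW pR) s0; have := mulr_ge0 (ltW pR) q0.
move=> h1 h2; have := mulr_ge0 (ltW cc0) h2; nra.
Qed.

Lemma KL_tail (d : nat -> R) :
  (forall k, (K <= k)%N -> d (k + p)%N <= C * Num.sqrt (D k - D (k + p + p)%N)) ->
  exists2 c : R, 0 < c & forall n N, (K + p <= n)%N ->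
    \sum_(n <= i < N) d i.+1 <=
      c * (Num.sqrt (D (n - p)%N) + D (n - p)%N `^ (1 - theta)).
Proof.
move=> dC; have C0 := ltW C_gt0; have [c c0 Hc] := sum_KL_gaps_le.
exists (C * (c + c)) => [|n N Kn]; first by rewrite mulr_gt0// addr_gt0.
set B := Num.sqrt _ + _.
have B0 : 0 <= B by rewrite addr_ge0 ?sqrtr_ge0 ?powR_ge0.
have [nN|Nn] := leqP n N; last first.
  rewrite big_geq; last exact: ltnW.
  by rewrite mulr_ge0// mulr_ge0// addr_ge0// ltW.
have Bn j : (n - p <= j)%N -> Num.sqrt (D j) + D j `^ (1 - theta) <= B.
  by move=> nj; rewrite lerD ?ler_wsqrtr ?D_homo// psi_homo.
have dE i : (n <= i)%N -> d i.+1 <= C * (E (i.+1 - p)%N + E i.+1).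
  move=> ni; have := dC (i.+1 - p)%N; rewrite subnK; last by lia.
  move=> /(_ ltac:(lia))/le_trans; apply; rewrite ler_pM2l//.
  have -> : D (i.+1 - p)%N - D (i.+1 + p)%N =
      (D (i.+1 - p)%N - D (i.+1 - p + p)%N) + (D i.+1 - D (i.+1 + p)%N).
    by rewrite subnK; [ring|lia].
  by apply: sqrtr_subadd; exact: dec.
apply: le_trans (_ : \sum_(n <= i < N) C * (E (i.+1 - p)%N + E i.+1) <= _).
  by apply: ler_sum_nat => i /andP[ni _]; exact: dE.
rewrite -mulr_sumr -mulrA ler_pM2l// big_split/= mulrDl lerD//.
- have -> : \sum_(n <= i < N) E (i.+1 - p)%N =
      \sum_(n - p.-1 <= i < N - p.-1) E i.
    rewrite -{1}[n](@subnK p.-1); last by lia.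
    by rewrite big_addn; apply: eq_bigr => i _; congr E; lia.
  apply: le_trans (Hc _ _ _) _; first by lia.
  by rewrite ler_pM2l// Bn//; lia.
- rewrite -[leLHS]/(\sum_(n <= i < N.+1.-1) E i.+1) -(big_add1 _ _ _ _ xpredT).
  apply: le_trans (Hc _ _ _) _; first by lia.
  by rewrite ler_pM2l// Bn//; lia.
Qed.

Let KL_sq k : (K <= k)%N ->
  D (k + p)%N `^ (theta * 2) <= C ^+ 2 * (D k - D (k + p)%N).
Proof.
move=> Kk; rewrite powRrM powR_mulrn ?powR_ge0//.
rewrite -[X in _ <= _ * X]sqr_sqrtr ?dec// -exprMn.
rewrite ler_pXn2r ?nnegrE ?powR_ge0 ?KL// mulr_ge0 ?sqrtr_ge0//; exact: ltW.
Qed.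

(** Since [D <= 1] and [2 * theta <= 1], [D (k+p) <= D (k+p)^(2 theta)]. *)
Lemma KL_linear_step k : theta <= 2^-1 -> (K <= k)%N ->
  D (k + p)%N <= C ^+ 2 / (1 + C ^+ 2) * D k.
Proof.
move=> th Kk; have C2 : 0 < C ^+ 2 by rewrite exprn_gt0.
suff h : D (k + p)%N <= C ^+ 2 * (D k - D (k + p)%N).
  by rewrite mulrAC ler_pdivlMr ?addr_gt0//; lra.
apply: le_trans (KL_sq Kk).
have := D_ge0 (k + p)%N; rewrite le_eqVlt => /predU1P[<-|Dp]; first exact: powR_ge0.
apply: ger1_powR; last by lra.
by rewrite Dp D_le1// (leq_trans Kk)// leq_addr.
Qed.

(** With [r = 2 * theta - 1], [u = D k] and [y = D (k+p)], concavity of [t^r]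
    gives [y^r * u <= u^r * (u - r * (u - y))].  The gain [r * (u - y)] is at
    least [r / (1 + C^2) * y^r * u]: split [u = (u - y) + y], bound [y^r] by [1]
    in the first part and use [y^(r+1) = y^(2 theta) <= C^2 * (u - y)] in the
    second. *)
Lemma KL_sublinear_step k : 2^-1 < theta -> (K <= k)%N ->
  D (k + p)%N `^ (2 * theta - 1) *
    (1 + (2 * theta - 1) / (1 + C ^+ 2) * D k `^ (2 * theta - 1)) <=
  D k `^ (2 * theta - 1).
Proof.
move=> th Kk; have C2 : 0 < C ^+ 2 by rewrite exprn_gt0.
set r := 2 * theta - 1; set u := D k; set y := D (k + p)%N.
have r01 : 0 < r < 1 by rewrite /r; case/andP: theta01 => *; apply/andP; split; lra.
have [r0 r1] := andP r01.
have uy : 0 <= u - y := dec k.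
have y0 : 0 <= y := D_ge0 _.
have := D_ge0 k; rewrite -/u le_eqVlt => /predU1P[u0|u0].
  have -> : y = 0 by lra.
  by rewrite -u0 powR0 ?gt_eqF// mul0r.
have yr1 : y `^ r <= 1.
  rewrite -(powRr0 y); move: (y0); rewrite le_eqVlt => /predU1P[<-|yp].
    by rewrite powR0 ?gt_eqF// powR_ge0.
  by rewrite ger_powR ?(ltW r0)// yp D_le1// (leq_trans Kk)// leq_addr.
set yr := y `^ r; set ur := u `^ r.
have yr0 : 0 <= yr := powR_ge0 _ _.
have ur0 : 0 <= ur := powR_ge0 _ _.
have am := weighted_am_gm r01 y0 (ltW u0).
have uE : u `^ (1 - r) * ur = u.
  by rewrite -powRD subrK ?powRr1 ?(ltW u0)// oner_eq0.
have h1 : yr * u <= (r * y + (1 - r) * u) * ur.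
  by rewrite -{1}uE mulrA ler_wpM2r.
have yE : yr * y <= C ^+ 2 * (u - y).
  have := KL_sq Kk; rewrite (_ : theta * 2 = r + 1); last by rewrite /r; lra.
  rewrite powRD; last by rewrite gt_eqF// addr_gt0.
  by rewrite powRr1.
have h2 : r / (1 + C ^+ 2) * (yr * u) <= r * (u - y).
  rewrite -mulrA ler_pM2l// ler_pdivrMl ?addr_gt0// mulrDl mul1r.
  have : yr * (u - y) <= u - y by rewrite ler_piMl.
  by move: yE; lra.
rewrite -(ler_pM2r u0).
have -> : yr * (1 + r / (1 + C ^+ 2) * ur) * u =
  yr * u + ur * (r / (1 + C ^+ 2) * (yr * u)) by ring.
apply: le_trans (lerD h1 (ler_wpM2l ur0 h2)) _.
by rewrite le_eqVlt; apply/orP; left; apply/eqP; ring.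
Qed.

(** As [D <= 1], the larger term of the tail bound
    [sqrt (D n) + (D n)^(1-theta)] is the first for [theta <= 1/2] and the
    second for [theta > 1/2].  In the latter case [rho] is arbitrary. *)
Lemma KL_rate (d : nat -> R) :
  (forall k, (K <= k)%N -> d (k + p)%N <= C * Num.sqrt (D k - D (k + p + p)%N)) ->
  exists gamma rho : R, [/\ 0 < gamma, 0 < rho < 1 &
    \forall n \near \oo, forall N, \sum_(n <= i < N) d i.+1 <=
      if theta <= 2^-1 then gamma * rho ^+ n
      else gamma * n%:R `^ ((1 - theta) / (1 - 2 * theta))].
Proof.
move=> /KL_tail[c c0 tail].
have C2 : 0 < C ^+ 2 by rewrite exprn_gt0.
have pR : 0 < p%:R :> R by rewrite ltr0n.
have [th|th] := leP theta 2^-1.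
  have q01 : 0 < C ^+ 2 / (1 + C ^+ 2) < 1.
    by rewrite divr_gt0 ?addr_gt0//= ltr_pdivrMr ?addr_gt0// mul1r ltrDr.
  have [M [rho [M0 /andP[rho0 rho1] HD]]] :=
    linear_rate p_gt0 q01 D_ge0 D_homo (fun k => KL_linear_step th).
  have sr0 : 0 < Num.sqrt rho by rewrite sqrtr_gt0.
  exists (c * 2 * Num.sqrt M / Num.sqrt rho ^+ p), (Num.sqrt rho); split.
  - by rewrite divr_gt0 ?exprn_gt0// !mulr_gt0// sqrtr_gt0.
  - by rewrite sr0 -sqrtr1 ltr_sqrt.
  exists (K + p)%N => // n /= Kn N; apply: le_trans (tail n N Kn) _.
  have Kn' : (K <= n - p)%N by clear -Kn; lia.
  have sqrtX k : Num.sqrt (rho ^+ k) = Num.sqrt rho ^+ k.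
    by elim: k => [|k IH]; rewrite ?expr0 ?sqrtr1// !exprS sqrtrM ?ltW// IH.
  have s1 : Num.sqrt (D (n - p)%N) <= Num.sqrt M * Num.sqrt rho ^+ (n - p).
    by rewrite -sqrtX -sqrtrM ?(ltW M0)// ler_wsqrtr// HD.
  have s2 : D (n - p)%N `^ (1 - theta) <= Num.sqrt (D (n - p)%N).
    rewrite -powR12_sqrt//; have := D_ge0 (n - p)%N; rewrite le_eqVlt.
    move=> /predU1P[<-|Dp].
      by rewrite !powR0// ?invr_eq0 ?pnatr_eq0// gt_eqF.
    by rewrite ger_powR ?Dp ?D_le1//; lra.
  have -> : c * 2 * Num.sqrt M / Num.sqrt rho ^+ p * Num.sqrt rho ^+ n =
      c * (2 * (Num.sqrt M * Num.sqrt rho ^+ (n - p))).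
    rewrite -{1}(@subnK p n); last by clear -Kn; lia.
    rewrite exprD; field; by rewrite lt0r_neq0// ?exprn_gt0.
  by rewrite ler_pM2l//; lra.
pose r := 2 * theta - 1; have r0 : 0 < r by rewrite /r; lra.
pose kap := r / (1 + C ^+ 2).
have kap0 : 0 < kap by rewrite divr_gt0// addr_gt0.
have HD := sublinear_rate p_gt0 kap0 (fun k => powR_ge0 (D k) r)
  (fun k => KL_sublinear_step th).
pose G := 2 * p%:R / kap; pose s := (1 - theta) / r.
have G0 : 0 < G by rewrite divr_gt0// mulr_gt0.
exists (c * 2 * G `^ s), 2^-1; split.
- by rewrite !mulr_gt0// powR_gt0.
- by apply/andP; split; lra.
exists (2 * (K + p + p))%N.+1 => // n /= Kn N.
apply: le_trans (tail n N _) _; first by clear -Kn; lia.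
have Kn' : (K <= n - p)%N by clear -Kn; lia.
have n0 : 0 < n%:R :> R by rewrite ltr0n; clear -Kn; lia.
have wn : D (n - p)%N `^ r <= G * n%:R^-1.
  have := HD _ Kn'; rewrite ler_pdivlMr// /G ler_pdivlMr//.
  have : n%:R <= 2 * ((n - p)%:R - (K + p)%:R) :> R.
    rewrite -natrB; last by clear -Kn; lia.
    by rewrite -natrM ler_nat; clear -Kn; lia.
  have := powR_ge0 (D (n - p)%N) r; set w := _ `^ r => w0 h1 h2.
  have := ler_wpM2l (ltW kap0) (ler_wpM2l w0 h1); lra.
have s2 : D (n - p)%N `^ (1 - theta) <= G `^ s * n%:R `^ (- s).
  rewrite (_ : 1 - theta = r * s); last by rewrite /s mulrC divfK ?gt_eqF.
  rewrite powRrM (_ : - s = -1 * s); last by rewrite mulN1r.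
  rewrite [X in _ * X]powRrM powR_inv1// -powRM ?invr_ge0 ?(ltW G0)//.
  apply: ge0_ler_powR => //; rewrite ?nnegrE ?powR_ge0//.
    by rewrite divr_ge0 ?(ltW r0)// ltW.
  by rewrite mulr_ge0 ?(ltW G0)// invr_ge0.
have s1 : Num.sqrt (D (n - p)%N) <= D (n - p)%N `^ (1 - theta).
  rewrite -powR12_sqrt//; have := D_ge0 (n - p)%N; rewrite le_eqVlt.
  move=> /predU1P[<-|Dp].
    by rewrite !powR0// ?invr_eq0 ?pnatr_eq0// gt_eqF.
  by rewrite ger_powR ?Dp ?D_le1//; lra.
have -> : (1 - theta) / (1 - 2 * theta) = - s.
  by rewrite /s -[RHS]mulrN -invrN /r opprB.
rewrite -!mulrA ler_pM2l//; lra.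
Qed.

End KLRecurrence.
End Rates.

(** * From the KL property to a descent recurrence *)

(* [y k] abstracts [z (l (k + m.+1))], [F k] the value of [Phi] at its first
   component, [G k] the upper bound on [h (y k)], and [e k] the length of the
   step that ends there. *)
Section KLAlongSequence.
Context (R : realType) (E : euclideanType R) (h : E -> \bar R) (theta b : R).
Context (y : nat -> E) (F G e : nat -> R) (om M : R).
Hypothesis theta01 : 0 <= theta < 1.
Hypothesis h_lsc : lower_semicontinuous h.
Hypothesis h_KL : KL_function theta h.
Hypothesis y_bounded : forall k, `|y k| <= M.
Hypothesis F_ge : forall k, om <= F k.
Hypothesis h_between : forall k, ((F k)%:E <= h (y k) <= (G k)%:E)%E.
Hypothesis G_cvg : G @ \oo --> om.
Hypothesis e_cvg : e @ \oo --> 0.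
Hypothesis h_slope : forall k,
  (dist 0%R (limiting_subdiff h (y k)) <= (b * e k)%:E)%E.
Hypothesis h_cluster : forall (s : nat -> nat) w, increasing_seq s ->
  y \o s @ \oo --> w -> (om%:E <= h w)%E.

Let h_fin k : h (y k) \is a fin_num.
Proof.
have /andP[h1 h2] := h_between k.
by rewrite fin_numElt (lt_le_trans _ h1) ?ltNyr// (le_lt_trans h2) ?ltry.
Qed.

(** Lower semicontinuity and the upper bound [G -> om] give [h w <= om]. *)
Lemma cluster_value (s : nat -> nat) w : increasing_seq s ->
  y \o s @ \oo --> w -> h w = om%:E.
Proof.
move=> hs yw; apply/eqP; rewrite eq_le (h_cluster hs yw) andbT leNgt.
apply/negP => om_lt.
have [r omr rh] : exists2 r : R, om < r & (r%:E < h w)%E.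
  move: om_lt; case: (h w) => [q| |]; last by rewrite ltNge leNye.
    by rewrite lte_fin => omq; exists ((om + q) / 2); rewrite ?lte_fin; lra.
  by exists (om + 1); [rewrite ltrDl|rewrite ltry].
have [V Vw Vr] := h_lsc rh.
have Gs : G \o s @ \oo --> om.
  by apply: cvgn_subseq G_cvg => n; exact: increasing_seq_ge_id.
near \oo => k.
have : (r%:E < h (y (s k)))%E by apply: Vr; near: k; exact: yw.
have /andP[_ hG] := h_between (s k).
move/lt_le_trans => /(_ _ hG); rewrite lte_fin ltNge => /negP; apply.
by near: k; exact: (cvgr_le _ Gs _ omr).
Unshelve. all: by end_near. Qed.

Lemma cluster_value_cvg (s : nat -> nat) w : increasing_seq s ->
  y \o s @ \oo --> w -> h \o (y \o s) @ \oo --> h w.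
Proof.
move=> hs yw; rewrite (cluster_value hs yw).
apply: (@squeeze_cvge _ _ _ _ (cst om%:E) _ (fun k => (G (s k))%:E)).
- apply: nearW => k /=; have /andP[h1 h2] := h_between (s k); rewrite h2 andbT.
  by apply: le_trans h1; rewrite lee_fin.
- exact: cvg_cst.
- apply: cvg_EFin; first exact: nearW.
  by apply: (@cvgn_subseq _ G) G_cvg => n; exact: increasing_seq_ge_id.
Qed.

Lemma cluster_critical (s : nat -> nat) w : increasing_seq s ->
  y \o s @ \oo --> w -> limiting_subdiff h w 0.
Proof.
move=> hs yw.
have ex k : exists v, limiting_subdiff h (y (s k)) v /\
    `|v| < b * e (s k) + k.+1%:R^-1.
  have : (dist 0%R (limiting_subdiff h (y (s k))) <
      (b * e (s k) + k.+1%:R^-1)%:E)%E.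
    by apply: le_lt_trans (h_slope _) _; rewrite lte_fin ltrDl invr_gt0.
  by move=> /dist_lt_ex[v vS]; rewrite sub0r normrN => vl; exists v.
have [v /all_and2[vS vl]] := choice ex.
apply: (@limiting_subdiff_closed _ _ h (y \o s) v) => //.
- by rewrite (cluster_value hs yw).
- exact: cluster_value_cvg.
have es : e \o s @ \oo --> 0.
  by apply: cvgn_subseq e_cvg => n; exact: increasing_seq_ge_id.
have bnd : (fun k => b * e (s k) + k.+1%:R^-1) @ \oo --> 0.
  rewrite -[X in _ --> X]addr0 -{1}[0](mulr0 b).
  by apply: cvgD; [exact: cvgMl_tmp es|exact: cvg_harmonic].
apply/cvgrPdist_lt => r r0; near=> k; rewrite sub0r normrN.
apply: lt_trans (vl k) _; near: k; exact: (cvgr_lt _ bnd _ r0).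
Unshelve. all: by end_near. Qed.

(** Arguing by contradiction along violating indices localises at a single
    cluster point, in place of a KL inequality uniform over the set of cluster
    points. *)
Lemma KL_along_sequence : (forall k, 0 <= e k) ->
  exists (C : R) (K : nat), 0 < C /\ forall k, (K <= k)%N ->
    om < F k -> (F k - om) `^ theta <= C * e k.
Proof.
move=> e_ge0; apply: contrapT => no.
have [K n|kap kap_incr viol] := @increasing_seq_choice (fun n k =>
    om < F k /\ n.+1%:R * e k < (F k - om) `^ theta).
  apply: contrapT => nok; apply: no; exists n.+1%:R, K; split=> // k Kk omF.
  by rewrite leNgt; apply/negP => lt; apply: nok; exists k.
have [s [w [s_incr yw]]] :=
  euclidean_bolzano_weierstrass (u := y \o kap) (fun k => y_bounded _).
have ks_incr := increasing_seq_comp kap_incr s_incr.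
have hw := cluster_value ks_incr yw.
have crit := cluster_critical ks_incr yw.
have hwfin : h w \is a fin_num by rewrite hw.
have dom : dom_subdiff h w by exists 0.
have [eta [c [eta0 c0 near_w]]] := KL_at_powR theta01 hwfin (h_KL dom).
have hcvg := cluster_value_cvg ks_incr yw.
have hcvgR : (fun k => fine (h (y (kap (s k))))) @ \oo --> om.
  by apply: fine_cvg; rewrite -hw.
near \oo => k.
have [omF lt] := viol (s k).
have t_lt : fine (h (y (kap (s k)))) < om + eta.
  by near: k; apply: (cvgr_lt _ hcvgR _); rewrite ltrDl.
have KL_k : forall t d : R, h (y (kap (s k))) = (fine (h w) + t)%:E ->
    0 < t < eta ->
    (dist 0%R (limiting_subdiff h (y (kap (s k)))) <= d%:E)%E ->
    t `^ theta <= c * d by near: k; exact: yw near_w.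
set q := kap (s k) in omF lt t_lt KL_k.
have /andP[Fh _] := h_between q.
have hq := fineK (h_fin q).
have Fh' : F q <= fine (h (y q)) by rewrite -lee_fin hq.
have loj : (fine (h (y q)) - om) `^ theta <= c * (b * e q).
  apply: (KL_k _ _ _ _ (h_slope q)).
  - by rewrite hw /= addrC subrK -/q hq.
  - by apply/andP; split; lra.
have big : c * b <= (s k).+1%:R.
  apply: le_trans (_ : k%:R <= _).
    near: k; exact: nbhs_infty_ger.
  by rewrite ler_nat (leq_trans (increasing_seq_ge_id k s_incr)).
have := lt_le_trans lt (le_trans (_ : _ <= (fine (h (y q)) - om) `^ theta) loj).
have [th0 _] := andP theta01.
rewrite ltNge mulrA ler_wpM2r// => /(_ _)/negP; apply=> //.
apply: ge0_ler_powR; rewrite ?nnegrE ?subr_ge0 ?F_ge// ?lerD2r//.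
exact: le_trans (F_ge q) Fh'.
Unshelve. all: by end_near. Qed.

End KLAlongSequence.

(** * Convergence from summable steps *)

Lemma dist_le_sum_steps (R : realType) (V : normedModType R) (x : nat -> V) k n :
  (k <= n)%N -> `|x k - x n| <= \sum_(k <= j < n) `|x j.+1 - x j|.
Proof.
elim: n => [|n IH]; first by rewrite leqn0 => /eqP ->; rewrite subrr normr0 sumr_ge0.
rewrite leq_eqVlt => /predU1P[->|]; first by rewrite subrr normr0 sumr_ge0.
rewrite ltnS => kn; rewrite big_nat_recr//= (_ : x k - x n.+1 =
  (x k - x n) - (x n.+1 - x n)); last by rewrite opprB addrA subrK.
by apply: le_trans (ler_normB _ _) _; rewrite lerD2r IH.
Qed.

(** The subsequence supplies the limit, which stands in for completeness of
    [V]; the tails of the steps bound the distance to it. *)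
Lemma cvg_of_summable_steps (R : realType) (V : normedModType R) (x : nat -> V)
    (s : nat -> nat) (xbar : V) (K : nat) (B : R) :
  (forall n, (n <= s n)%N) -> x \o s @ \oo --> xbar ->
  (forall N, \sum_(K <= j < N) `|x j.+1 - x j| <= B) ->
  x @ \oo --> xbar /\
  forall k, ((`|x k - xbar|)%:E <= \sum_(k <= j <oo) (`|x j.+1 - x j|)%:E)%E.
Proof.
move=> sge xs sumB.
have le_tail k :
    ((`|x k - xbar|)%:E <= \sum_(k <= j <oo) (`|x j.+1 - x j|)%:E)%E.
  apply/lee_addgt0Pr => r r0; near \oo => n.
  apply: le_trans (_ : ((`|x k - x (s n)|)%:E + r%:E <= _)%E).
    rewrite -EFinD lee_fin.
    have -> : x k - xbar = (x k - x (s n)) + (x (s n) - xbar).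
      by rewrite addrA subrK.
    apply: le_trans (ler_normD _ _) _; rewrite lerD2l distrC ltW//.
    by near: n; move/cvgrPdist_lt: xs; exact.
  rewrite leeD2r//.
  apply: le_trans (_ : \sum_(k <= j < s n) (`|x j.+1 - x j|)%:E <= _)%E.
    rewrite sumEFin lee_fin dist_le_sum_steps//.
    apply: leq_trans (sge n); near: n; exact: nbhs_infty_ge.
  by apply: nneseries_lim_ge => j _ _; rewrite lee_fin.
split=> //.
have fin : (\sum_(0 <= j <oo) (`|x j.+1 - x j|)%:E < +oo)%E.
  apply: le_lt_trans (ltry (\sum_(0 <= j < K) `|x j.+1 - x j| + B)).
  apply: lime_le; first by apply: is_cvg_nneseries => j _ _; rewrite lee_fin.
  near=> n; rewrite sumEFin lee_fin (@big_cat_nat _ _ _ K)//=.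
    by rewrite lerD2l.
  near: n; exact: nbhs_infty_ge.
have := @nneseries_tail_cvg R (fun j => (`|x j.+1 - x j|)%:E) xpredT fin.
move=> /(_ (fun j _ => normr_ge0 (x j.+1 - x j))) tail0.
apply/cvgrPdist_le => r r0.
have /fine_cvgP[tfin /cvgrPdist_le/(_ _ r0) tle] := tail0.
near=> n; rewrite distrC -lee_fin; apply: le_trans (le_tail n) _.
have tn : (\sum_(n <= j <oo) (`|x j.+1 - x j|)%:E)%E \is a fin_num.
  by near: n; exact: tfin.
rewrite -(fineK tn) lee_fin; apply: le_trans (ler_norm _) _.
by rewrite -[leLHS]normrN -sub0r; near: n; exact: tle.
Unshelve. all: by end_near. Qed.

(** * Convergence and rates *)

Theorem theorem6 (R : realType) (X Y : euclideanType R)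
    (Phi : X -> \bar R) (m : nat) (x : nat -> X) (z : nat -> l2prod X Y)
    (a : R) (Theta : l2prod X Y -> \bar R) (theta : R) (vs : nat -> R) (b : R)
    (tau mu : R) (kbar : nat) :
  proper_efun Phi -> lower_semicontinuous Phi ->
  (exists M : R, forall u, (M%:E <= Phi u)%E) ->
  (Phi (x 0%N) < +oo)%E ->
  (forall k, (z k).1 = x k) ->
  let l := ell Phi x m in
  (* (a) *)
  0 < a ->
  (forall k, (Phi (x k.+1) + (a * `|x k.+1 - x k| ^+ 2)%:E <= Phi (x (l k)))%E) ->
  (* (b) *)
  (forall (s : nat -> nat) (xs : X), increasing_seq s ->
    (fun j => x (l (s j))) @ \oo --> xs ->
    (limn_esup (fun j => Phi (x (l (s j)))) <= Phi xs)%E) ->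
  (* (c) *)
  proper_efun Theta -> lower_semicontinuous Theta ->
  0 <= theta < 1 -> KL_function theta Theta ->
  (forall k, 0 <= vs k) -> vs @ \oo --> 0 ->
  0 < b ->
  (forall w, cluster (z @ \oo) w -> (Phi w.1 <= Theta w)%E) ->
  (forall k, (Phi (x k.+1) <= Theta (z k.+1) <= Phi (x (l k)) + (vs k)%:E)%E) ->
  (forall k, (1 <= k)%N ->
    (dist 0%R (limiting_subdiff Theta (z k)) <= (b * `|x k - x k.-1|)%:E)%E) ->
  (* (d) *)
  0 < tau < 1 -> 0 < mu -> (m < kbar)%N ->
  (forall k, (kbar <= k)%N ->
    forall i, (l (k - 1) + 1 <= i <= l k - 1)%N ->
    (sqrte (Phi (x (l k)) - Phi (x i)) <=
      (tau * Num.sqrt a * `|x i - x i.-1| +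
       mu * \sum_(i + 1 <= j < (l k).+1) `|x j - x j.-1|)%:E)%E) ->
  bounded_set (range z) ->
  exists xbar : X,
    [/\ x @ \oo --> xbar,
        theta = 0 -> \forall k \near \oo, x k = xbar &
        0 < theta -> exists gamma rho : R,
          [/\ 0 < gamma, 0 < rho < 1 &
            \forall k \near \oo,
              ((`|x k - xbar|)%:E <=
                 \sum_(k <= j <oo) (`|x j.+1 - x j|)%:E <=
               (if theta <= 2^-1 then gamma * rho ^+ k
                else gamma * k%:R `^ ((1 - theta) / (1 - 2 * theta)))%:E)%E]].
Proof.
move=> Phi_proper _ [M0 Phi_ge] Phi0 zx l a0 desc usc _ Theta_lsc th01 Theta_KL.
move=> vs0 vs_cvg b0 Theta_cl Theta_bt slope tau01 mu0 kbar_gt between z_bd.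
set p := m.+1.
have desc' k : (Phi (x k.+1) <= Phi (x (l k)))%E.
  apply: le_trans (desc k); rewrite leeDl// lee_fin mulr_ge0 ?sqr_ge0//.
  exact: ltW.
have l_window k : (k - m <= l k <= k)%N by have [] := ellP Phi x m k.
have Phi_fin k : Phi (x k) \is a fin_num.
  rewrite fin_numElt (Phi_proper.1 _)/=.
  elim/ltn_ind: k => -[//|k] IH; apply: le_lt_trans (desc' k) (IH _ _).
  by have /andP[] := l_window k.
pose f k := fine (Phi (x k)); pose d k := `|x k - x k.-1|.
have PhiE k : Phi (x k) = (f k)%:E by rewrite fineK.
have d_ge0 k : 0 <= d k := normr_ge0 _.
have l_max k i : (k - m <= i <= k)%N -> f i <= f (l k).
  move=> ki; rewrite -lee_fin -!PhiE.
  by have [_] := ellP Phi x m k; exact.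
have descR k : f k.+1 + a * d k.+1 ^+ 2 <= f (l k).
  by rewrite -lee_fin EFinD -!PhiE; exact: desc.
have F_homo := window_max_nonincreasing a0 l_window l_max descR.
pose F k := f (l k).
have F_lb : has_lbound (range F).
  by exists M0 => _ [k _ <-]; rewrite -lee_fin -PhiE.
pose om := inf (range F).
have F_cvg : F @ \oo --> om by apply: nonincreasing_cvgn F_lb; exact: F_homo.
have F_ge k : om <= F k by apply: ge_inf => //; exists k.
pose D k := F k - om.
have D_ge0 k : 0 <= D k by rewrite subr_ge0.
have D_homo : {homo D : i j / (i <= j)%N >-> j <= i}.
  by move=> i j ij; rewrite lerD2r; exact: F_homo.
have DB i j : D i - D j = F i - F j by rewrite /D; ring.
have shift k : (k <= k + p)%N by rewrite leq_addr.
have l_shift k : (k < l (k + p))%N.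
  by have /andP[+ _] := l_window (k + p)%N; rewrite /p; clear; lia.
have sa0 : 0 < Num.sqrt a by rewrite sqrtr_gt0.
have betweenR k : (kbar <= k)%N ->
    forall i, (l (k - 1) + 1 <= i <= l k - 1)%N ->
    Num.sqrt (F k - f i) <=
      tau * Num.sqrt a * d i + mu * \sum_(i + 1 <= j < (l k).+1) d j.
  by move=> kk i ik; have := between k kk i ik; rewrite !PhiE -EFinB /= lee_fin.
have [C1 C1_ge0 stepC1] :=
  step_length a0 d_ge0 l_window l_max descR tau01 mu0 kbar_gt betweenR.
(* The shift by [p] makes [l (k + p) >= 1], so that [x (l (k + p))] has a
   predecessor, and bounds that predecessor's index below by [k]. *)
pose e k := d (l (k + p)%N).
have e_ge0 k : 0 <= e k := d_ge0 _.
have e_le k : e k <= Num.sqrt (D k - D (k + p)%N) / Num.sqrt a.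
  rewrite ler_pdivlMr// mulrC.
  apply: le_trans (descent_step a0 d_ge0 descR _) _.
    exact: leq_ltn_trans (l_shift k).
  rewrite ler_wsqrtr// DB lerD2r; apply: F_homo.
  by have := l_shift k; clear; lia.
have gap_cvg : (fun k => Num.sqrt (D k - D (k + p)%N)) @ \oo --> 0.
  rewrite -sqrtr0; apply: continuous_cvg; first exact: sqrt_continuous.
  rewrite -[0](subrr om).
  rewrite [X in X @ _](_ : _ = fun k => F k - F (k + p)%N); last first.
    by apply/funext => k; rewrite DB.
  by apply: cvgB => //; exact: (cvgn_subseq shift F_cvg).
have e_cvg : e @ \oo --> 0.
  apply: (@squeeze_cvgr _ _ _ _ (cst 0)
    (fun k => Num.sqrt (D k - D (k + p)%N) / Num.sqrt a)).
  - by apply: nearW => k; rewrite e_ge0 e_le.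
  - exact: cvg_cst.
  - by rewrite -[0](mul0r (Num.sqrt a)^-1); apply: cvgMr_tmp.
have [M1 z_le] : exists M : R, forall k, `|z k| <= M.
  have [N [_ zN]] := z_bd; exists (N + 1) => k.
  by apply: (zN (N + 1)); [rewrite ltrDl|exists k].
pose y k := z (l (k + p)%N).
pose t k := (l (k + p)%N).-1.
have t_ge k : (k <= t k)%N by have := l_shift k; rewrite /t; clear; lia.
pose G k := F (t k) + vs (t k).
have G_cvg : G @ \oo --> om.
  rewrite -[om]addr0; apply: cvgD; first exact: (cvgn_subseq t_ge F_cvg).
  exact: (cvgn_subseq t_ge vs_cvg).
have tS k : (t k).+1 = l (k + p)%N.
  by rewrite prednK// (leq_ltn_trans _ (l_shift k)).
have Theta_y k : ((F (k + p)%N)%:E <= Theta (y k) <= (G k)%:E)%E.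
  have := Theta_bt (t k); rewrite tS => /andP[h1 h2].
  by rewrite EFinD -!PhiE h1 h2.
have y_cluster (s : nat -> nat) w : increasing_seq s ->
    y \o s @ \oo --> w -> (om%:E <= Theta w)%E.
  move=> hs yw.
  have s_ge n := increasing_seq_ge_id n hs.
  have cl : cluster (z @ \oo) w.
    move=> A B [N _ NA] /yw[N' _ NB].
    exists (y (s (N + N')%N)); split.
      apply: NA => /=; apply: leq_trans (leq_addr N' N) _.
      by apply: leq_trans (s_ge _) _; apply: ltnW.
    by apply: NB => /=; exact: leq_addl.
  apply: le_trans (Theta_cl w cl).
  have sp : increasing_seq (fun j => s j + p)%N.
    by move=> i j /=; rewrite leEnat leq_add2r -leEnat hs.
  have xw : (fun j => x (l (s j + p)%N)) @ \oo --> w.1.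
    have := cvg_fst_l2prod yw.
    rewrite [X in X @ _ --> _ -> _](_ : _ = fun j => x (l (s j + p)%N))//.
    by apply/funext => j; rewrite /= zx.
  apply: le_trans (usc _ _ sp xw).
  have Fs : (fun j => Phi (x (l (s j + p)%N))) @ \oo --> om%:E.
    rewrite [X in X @ _](_ : _ = fun j => (F (s j + p)%N)%:E); last first.
      by apply/funext => j; rewrite PhiE.
    apply: cvg_EFin; first exact: nearW.
    by apply: (@cvgn_subseq _ F) F_cvg => n; apply: leq_trans (s_ge n) (shift _).
  rewrite is_cvg_limn_esupE; last by apply/cvg_ex; exists om%:E.
  by rewrite (cvg_lim _ Fs).
have y_slope k : (dist 0%R (limiting_subdiff Theta (y k)) <= (b * e k)%:E)%E.
  by apply: slope; exact: leq_ltn_trans (l_shift k).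
have [C2 [K2 [C2_gt0 KLC2]]] := KL_along_sequence th01 Theta_lsc Theta_KL
  (fun k => z_le _) (fun k => F_ge _) Theta_y G_cvg e_cvg y_slope y_cluster e_ge0.
have [s [zbar [s_incr zs]]] := euclidean_bolzano_weierstrass z_le.
have s_ge n := increasing_seq_ge_id n s_incr.
have xs : x \o s @ \oo --> zbar.1.
  have := cvg_fst_l2prod zs.
  rewrite [X in X @ _ --> _ -> _](_ : _ = x \o s)//.
  by apply/funext => j; rewrite /= zx.
exists zbar.1.
have conclude K B (sumB : forall N, \sum_(K <= j < N) `|x j.+1 - x j| <= B) :=
  cvg_of_summable_steps s_ge xs sumB.
have [th0|th_neq0] := eqVneq theta 0.
  have Dz : \forall k \near \oo, D (k + p)%N = 0.
    near=> k; apply/eqP; rewrite eq_le D_ge0 andbT leNgt; apply/negP => Dk.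
    have omF : om < F (k + p)%N by rewrite -subr_gt0.
    have Kk : (K2 <= k)%N by near: k; exact: nbhs_infty_ge.
    have := KLC2 k Kk omF; rewrite th0 powRr0 leNgt => /negP; apply.
    rewrite mulrC -ltr_pdivlMr// mul1r; near: k.
    by apply: (cvgr_lt _ e_cvg _); rewrite invr_gt0.
  have [K dz] : exists K, forall k, (K <= k)%N -> x k.+1 = x k.
    have [K _ DK] := Dz; exists (K + p + p + kbar)%N => k Kk.
    apply/eqP; rewrite -subr_eq0 -normr_le0; apply: le_trans (stepC1 k.+1 _) _.
      by clear -Kk; lia.
    rewrite -DB.
    have -> : D (k.+1 - p)%N = 0.
      rewrite -(@subnK p (k.+1 - p)); last by clear -Kk; lia.
      by apply: DK => /=; clear -Kk; lia.
    have -> : D (k.+1 + p)%N = 0 by apply: DK => /=; clear -Kk; lia.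
    by rewrite subrr sqrtr0 mulr0.
  have x_cvg : x @ \oo --> zbar.1.
    apply: (proj1 (conclude K 0 _)) => N.
    by rewrite big_nat big1// => j /andP[Kj _]; rewrite dz// subrr normr0.
  split=> //; last by rewrite th0 ltxx.
  move=> _; exists K => // k /= Kk.
  have cst_x n : x (K + n)%N = x K.
    by elim: n => [|n IH]; rewrite ?addn0// addnS dz ?leq_addr.
  have xK : x @ \oo --> x K.
    apply: cvg_near_cst; exists K => // n /= Kn; by rewrite -(subnKC Kn) cst_x.
  rewrite -(subnKC Kk) cst_x; exact: (cvg_unique _ xK x_cvg).
have th_gt0 : 0 < theta by case/andP: th01; rewrite le_eqVlt eq_sym (negbTE th_neq0).
have th01' : 0 < theta < 1 by rewrite th_gt0; case/andP: th01.
pose C := C1 + C2 / Num.sqrt a.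
have C2a : 0 < C2 / Num.sqrt a by rewrite divr_gt0.
have C_gt0 : 0 < C by rewrite ltr_wpDl.
have [K3 _ D_le1] : \forall k \near \oo, D k <= 1.
  near=> k; rewrite /D lerBlDl; near: k.
  by apply: (cvgr_le _ F_cvg _); rewrite ltrDl.
pose K := (K2 + K3 + kbar)%N.
have KL_D k : (K <= k)%N ->
    D (k + p)%N `^ theta <= C * Num.sqrt (D k - D (k + p)%N).
  move=> Kk; have g0 := sqrtr_ge0 (D k - D (k + p)%N).
  have [D0|Dn0] := eqVneq (D (k + p)%N) 0.
    by rewrite D0 powR0// mulr_ge0// ltW.
  have omF : om < F (k + p)%N by rewrite -subr_gt0 lt0r Dn0 D_ge0.
  have K2k : (K2 <= k)%N by move: Kk; rewrite /K; clear; lia.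
  apply: le_trans (KLC2 k K2k omF) _.
  apply: le_trans (ler_wpM2l (ltW C2_gt0) (e_le k)) _.
  by rewrite mulrA mulrAC ler_wpM2r// lerDr.
have step_D k : (K <= k)%N ->
    d (k + p)%N <= C * Num.sqrt (D k - D (k + p + p)%N).
  move=> Kk; apply: le_trans (stepC1 (k + p)%N _) _.
    by move: Kk; rewrite /K; clear; lia.
  by rewrite addnK -DB ler_wpM2r ?sqrtr_ge0// lerDl ltW.
have D1 k : (K <= k)%N -> D k <= 1.
  by move=> Kk; apply: D_le1 => /=; move: Kk; rewrite /K; clear; lia.
have [gamma [rho [gamma0 rho01 [N0 _ rate]]]] :=
  KL_rate (ltn0Sn m) th01' C_gt0 D_ge0 D1 D_homo KL_D step_D.
have [x_cvg tail] := conclude N0 _ (rate N0 (leqnn N0)).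
split=> //; first by move=> th0; rewrite th0 ltxx in th_gt0.
move=> _; exists gamma, rho; split=> //; exists N0 => // k /= N0k.
rewrite tail/=; apply: lime_le.
  by apply: is_cvg_nneseries => j _ _; rewrite lee_fin.
by apply: nearW => N; rewrite sumEFin lee_fin; exact: rate.
Unshelve. all: by end_near. Qed.
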